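(* Let $\mathcal{X}$ be a finite non-empty set. Every path $\omega\in\mathcal{X}^{\mathbb{N}}$ is computably random for the vacuous coherent lower expectation $\underline{E}_v$ on $\mathcal{L}(\mathcal{X})$, defined by $\underline{E}_v(f):=\min f$ for all $f\in\mathcal{L}(\mathcal{X})$.
   Context: A gamble is a map $f:\mathcal{X}\to\mathbb{R}$; $\mathcal{L}(\mathcal{X})$ is the linear space of all gambles. A coherent lower expectation is a map $\underline{E}:\mathcal{L}(\mathcal{X})\to\mathbb{R}$ such that for all $f,g\in\mathcal{L}(\mathcal{X})$ and real $\alpha\ge 0$: $\min f\le\underline{E}(f)$; $\underline{E}(\alpha f)=\alpha\underline{E}(f)$; $\underline{E}(f)+\underline{E}(g)\le\underline{E}(f+g)$. Its conjugate upper expectation is $\overline{E}(f):=-\underline{E}(-f)$. Situations are the finite sequences $s=x_{1:n}=(x_1,\dots,x_n)\in\mathbb{S}:=\bigcup_{n\in\mathbb{N}_0}\mathcal{X}^n$, with $\square$ the empty sequence; $sx$ is the concatenation of $s\in\mathbb{S}$ and $x\in\mathcal{X}$. For a path $\omega=(x_1,x_2,\dots)\in\mathcal{X}^{\mathbb{N}}$, $\omega^n:=(x_1,\dots,x_n)$ for $n\in\mathbb{N}_0$. A real process is a map $F:\mathbb{S}\to\mathbb{R}$; its process difference is the gamble $\Delta F(s)$ given by $\Delta F(s)(x):=F(sx)-F(s)$. A net of rationals $\{r_{s,n}\}_{s\in\mathbb{S},n\in\mathbb{N}_0}$ is recursive if $r_{s,n}=(-1)^{\sigma(s,n)}a(s,n)/b(s,n)$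 for some recursive (Turing-computable) maps $a,b,\sigma:\mathbb{S}\times\mathbb{N}_0\to\mathbb{N}_0$ with $b$ nowhere zero. A real process $F$ is computable if there is a recursive net of rationals $\{r_{s,n}\}$ with $|r_{s,n}-F(s)|\le 2^{-N}$ for all $s\in\mathbb{S}$ and all $n\ge N$ in $\mathbb{N}_0$. A path $\omega$ is computably random for a coherent lower expectation $\underline{E}$ if there is no computable real process $M$ with $M(s)\ge 0$ and $\overline{E}(\Delta M(s))\le 0$ for all $s\in\mathbb{S}$ such that $\sup_{n\in\mathbb{N}_0}M(\omega^n)=+\infty$. *)

(* Defs.v *)
From HB Require Import structures.
From mathcomp Require Import all_boot all_order all_algebra.
From mathcomp Require Import all_classical all_reals ereal.

Set Implicit Arguments.
Unset Strict Implicit.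
Unset Printing Implicit Defensive.

Import Order.TTheory GRing.Theory Num.Theory.

Local Open Scope classical_set_scope.
Local Open Scope ring_scope.

(* Total recursive functions nat^k -> nat, in Kleene's presentation:
   minimisation is applied only to functions that have a zero for every value
   of the parameters.  Each constructor characterises the new function
   pointwise, so the class is closed under extensional equality. *)
Inductive mu_recursive : forall k : nat, (k.-tuple nat -> nat) -> Prop :=
| MuZero k (h : k.-tuple nat -> nat) :
    (forall v, h v = 0%N) -> mu_recursive h
| MuSucc (h : 1.-tuple nat -> nat) :
    (forall v, h v = (thead v).+1) -> mu_recursive h
| MuProj k (i : 'I_k) (h : k.-tuple nat -> nat) :
    (forall v, h v = tnth v i) -> mu_recursive h
| MuComp k m (f : m.-tuple nat -> nat) (g : 'I_m -> k.-tuple nat -> nat)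
    (h : k.-tuple nat -> nat) :
    mu_recursive f -> (forall i, mu_recursive (g i)) ->
    (forall v, h v = f [tuple g i v | i < m]) -> mu_recursive h
| MuPrec k (f : k.-tuple nat -> nat) (g : k.+2.-tuple nat -> nat)
    (h : k.+1.-tuple nat -> nat) :
    mu_recursive f -> mu_recursive g ->
    (forall v : k.-tuple nat, h [tuple of 0%N :: v] = f v) ->
    (forall n (v : k.-tuple nat), h [tuple of n.+1 :: v] =
                 g [tuple of n :: h [tuple of n :: v] :: v]) ->
    mu_recursive h
| MuMin k (f : k.+1.-tuple nat -> nat) (h : k.-tuple nat -> nat) :
    mu_recursive f ->
    (forall v : k.-tuple nat, f [tuple of h v :: v] = 0%N) ->
    (forall (v : k.-tuple nat) n, (n < h v)%N -> f [tuple of n :: v] <> 0%N) ->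
    mu_recursive h.

Section Situations.
Variable X : finType.

Definition situation := seq X.

(* [path] is already taken by the library.  Paths are indexed from 0, so the
   n-th outcome of the path w is [w n.-1]. *)
Definition outcome_path := nat -> X.

Definition path_prefix (w : outcome_path) (n : nat) : situation := mkseq w n.

(* [CodeSeq.code] is an effective bijection from [seq nat] to [nat]; outcomes
   are numbered by the enumeration of the finite type. *)
Definition situation_code (s : situation) : nat :=
  CodeSeq.code [seq nat_of_ord (enum_rank x) | x <- s].

Definition recursive_map (f : situation -> nat -> nat) : Prop :=
  exists phi : 2.-tuple nat -> nat,
    mu_recursive phi /\ forall s n, f s n = phi [tuple situation_code s; n].

Definition recursive_net (r : situation -> nat -> rat) : Prop :=
  exists a b sigma : situation -> nat -> nat,
    [/\ recursive_map a, recursive_map b, recursive_map sigma,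
        (forall s n, b s n <> 0%N) &
        forall s n, r s n = (-1) ^+ sigma s n * (a s n)%:R / (b s n)%:R].

End Situations.

Section Gambles.
Variables (R : realType) (X : finType).

Definition gamble := X -> R.

Definition real_process := situation X -> R.

Definition process_difference (F : real_process) (s : situation X) : gamble :=
  fun x => F (rcons s x) - F s.

Definition computable_process (F : real_process) : Prop :=
  exists r : situation X -> nat -> rat,
    recursive_net r /\
    forall (s : situation X) (N n : nat),
      (N <= n)%N -> `|ratr (r s n) - F s| <= 2 ^- N.

Variable hX : (0 < #|X|)%N.

(* The element of X serves only to make [arg min] well defined. *)
Definition gamble_min (f : gamble) : R :=
  f [arg min_(x < enum_val (Ordinal hX)) f x]%O.

Lemma gamble_min_le (f : gamble) (x : X) : gamble_min f <= f x.
Proof. by rewrite /gamble_min; case: arg_minP => // i _; apply. Qed.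

Lemma gamble_min_attained (f : gamble) : exists x, gamble_min f = f x.
Proof. by eexists. Qed.

Record coherent_lower_expectation := CoherentLowerExpectation {
  lower_exp :> gamble -> R;
  lower_exp_min : forall f, gamble_min f <= lower_exp f;
  lower_exp_homo : forall (f : gamble) (alpha : R),
    0 <= alpha -> lower_exp (alpha \*o f) = alpha * lower_exp f;
  lower_exp_superadd : forall f g : gamble,
    lower_exp f + lower_exp g <= lower_exp (f \+ g)
}.

Definition upper_exp (E : coherent_lower_expectation) (f : gamble) : R :=
  - E (\- f).

Definition computably_random (E : coherent_lower_expectation)
    (w : outcome_path X) : Prop :=
  ~ exists M : real_process,
    [/\ computable_process M,
        (forall s, 0 <= M s),
        (forall s, upper_exp E (process_difference M s) <= 0) &
        ereal_sup [set (M (path_prefix w n))%:E | n in [set: nat]] = +oo%E].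

Lemma gamble_min_homo (f : gamble) (alpha : R) :
  0 <= alpha -> gamble_min (alpha \*o f) = alpha * gamble_min f.
Proof.
move=> a0; apply/eqP; rewrite eq_le; apply/andP; split.
  have [x ->] := gamble_min_attained f.
  exact: (gamble_min_le (alpha \*o f) x).
have [x ->] := gamble_min_attained (alpha \*o f).
by rewrite /= ler_wpM2l // gamble_min_le.
Qed.

Lemma gamble_min_superadd (f g : gamble) :
  gamble_min f + gamble_min g <= gamble_min (f \+ g).
Proof.
have [x ->] := gamble_min_attained (f \+ g).
by rewrite /= lerD // gamble_min_le.
Qed.

Definition vacuous_lower_expectation : coherent_lower_expectation :=
  @CoherentLowerExpectation gamble_min (fun f => lexx (gamble_min f))
    gamble_min_homo gamble_min_superadd.

End Gambles.

(* Main.v *)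
(* The vacuous upper expectation is the maximum, so a supermartingale for it
   cannot increase along any path and stays below its initial value. *)
Require Import Defs.
From HB Require Import structures.
From mathcomp Require Import all_boot all_order all_algebra.
From mathcomp Require Import all_classical all_reals ereal.

Import Order.TTheory GRing.Theory Num.Theory.

Local Open Scope ring_scope.

(** The vacuous upper expectation dominates each value of a gamble ([le_vacuous_upper_exp]), so
    every one-step increment of [M] is at most 0. Induction along [w] bounds [M] by the real number
    [M [::]], so its supremum there is finite. *)

Lemma path_prefixS (X : finType) (w : outcome_path X) (n : nat) :
  path_prefix w n.+1 = rcons (path_prefix w n) (w n).
Proof. by rewrite /path_prefix mkseqS. Qed.

Lemma le_vacuous_upper_exp (R : realType) (X : finType) (hX : (0 < #|X|)%N)
    (f : gamble R X) (x : X) :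
  f x <= upper_exp (vacuous_lower_expectation R hX) f.
Proof. by rewrite lerNr; exact: (gamble_min_le hX (\- f) x). Qed.

Lemma vacuous_supermartingale_le_init (R : realType) (X : finType)
    (hX : (0 < #|X|)%N) (M : real_process R X) (w : outcome_path X) (n : nat) :
  (forall s, upper_exp (vacuous_lower_expectation R hX)
               (process_difference M s) <= 0) ->
  M (path_prefix w n) <= M [::].
Proof.
move=> dM; elim: n => [|n IHn]; first exact: lexx.
rewrite path_prefixS (le_trans _ IHn) // -subr_le0.
(* The increment is [process_difference M (path_prefix w n)] evaluated at the next outcome [w n]. *)
apply: le_trans (dM (path_prefix w n)).
exact: (le_vacuous_upper_exp _ _ hX (process_difference M _) (w n)).
Qed.

Theorem corollary12 (R : realType) (X : finType) (hX : (0 < #|X|)%N)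
    (w : outcome_path X) :
  computably_random (vacuous_lower_expectation R hX) w.
Proof.
move=> [M [_ _ dM supM]].
have: (ereal_sup [set (M (path_prefix w n))%:E | n in [set: nat]]
         <= (M [::])%:E)%E.
  apply: ge_ereal_sup => _ [n _ <-].
  by rewrite lee_fin (vacuous_supermartingale_le_init _ _ hX).
(* An infinite supremum would force the real [M [::]] to equal [+oo]. *)
by rewrite supM leye_eq.
Qed.
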